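(* Let $n$ be a positive integer and let $\mathcal{F}\subseteq 2^{[n]}$ be an IU-family, i.e. for all $F,G\in\mathcal{F}$ one has $F\cap G\neq\emptyset$ and $F\cup G\neq[n]$. Then $$ \lVert\mathcal F\rVert_n=\sum_{F\in\mathcal F}\binom{n}{|F|}^{-1}\leq \frac{n+1}{6}. $$ Moreover, equality holds if and only if $\mathcal{F}=\{F\subseteq [n]: i\in F,\ j\notin F\}$ for some distinct $i,j\in [n]$.
   Context: Here $[n]=\{1,2,\ldots,n\}$ and $2^{[n]}$ denotes its power set. A family $\mathcal{F}\subseteq 2^{[n]}$ is called an intersecting-union family (IU-family) if for all $F,G\in\mathcal{F}$ (including the case $F=G$), $F\cap G\neq\emptyset$ and $F\cup G\neq [n]$. The binomial norm of a family $\mathcal{F}\subseteq 2^{[n]}$ is the real number $\lVert\mathcal F\rVert_n:=\sum_{F\in\mathcal F}\binom{n}{|F|}^{-1}$. *)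

(* Defs.v *)
From mathcomp Require Import all_boot all_order all_algebra.

Set Implicit Arguments.
Unset Strict Implicit.
Unset Printing Implicit Defensive.

Import GRing.Theory.
Local Open Scope ring_scope.

(* The ground set [n] = {1, ..., n} is represented by 'I_n = {0, ..., n - 1}. *)

Definition IU_family (n : nat) (F : {set {set 'I_n}}) : Prop :=
  forall A B : {set 'I_n}, A \in F -> B \in F ->
    A :&: B <> set0 /\ A :|: B <> [set: 'I_n].

Definition binomial_norm (R : realFieldType) (n : nat) (F : {set {set 'I_n}}) : R :=
  \sum_(A in F) ('C(n, #|A|))%:R^-1.

(* Main.v *)
Require Import Defs.
From mathcomp Require Import all_boot all_order all_algebra.
From mathcomp Require Import zify ring lra polyrcf realalg.

Set Implicit Arguments.
Unset Strict Implicit.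
Unset Printing Implicit Defensive.

Import Order.TTheory GRing.Theory Num.Theory.
Local Open Scope ring_scope.

(** Fix p in [0, 1] and let mu_p(F) be the probability that a random subset of
    [n], containing each point independently with probability p, belongs to F.
    Since the integral over [0, 1] of p^k (1 - p)^(n - k) is
    1 / ((n + 1) C(n, k)), the binomial norm of F is (n + 1) times the integral
    of mu_p(F).  The family of the sets containing i and missing j has
    mu_p = p (1 - p), whose integral is 1/6.

    For an IU-family F the inequality mu_p(F) <= p (1 - p) may fail for some p,
    but it holds after symmetrization: for 0 <= p <= 1/2,
        mu_p(F) + mu_{1-p}(F) <= 2 p (1 - p)            ([IU_mass_add_le]).
    Let U and D be the up-closure and the down-closure of F.  The correlation
    inequality [harris] gives mu_p(F) <= mu_p(U) mu_p(D).  The family U is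
    intersecting, hence mu_p(U) <= p ([intersecting_mass_le]) and
    mu_p(U) + mu_{1-p}(U) <= 1 ([intersecting_mass_add_le]); the complements of
    the members of D also form an intersecting family, so the same holds for D
    with p and 1 - p exchanged.  With a = mu_p(U) <= p and
    b = mu_{1-p}(D) <= p, the left-hand side is at most
    a (1 - b) + (1 - a) b, which is nondecreasing in each of a, b <= 1/2 and
    equals 2 p (1 - p) at a = b = p.

    For the equality case, the difference of the two sides is a polynomial in p
    ([deficit]), nonnegative on [0, 1]; if its integral vanishes, so do all of
    its coefficients.  The coefficient of p is 2 minus the number of singletons
    in F minus the number of complements of singletons in F, and each of these
    two numbers is at most 1 in an IU-family.  Thus F contains some {i} and
    some [n] - {j}, which forces each member of F to contain i and to miss j;
    a comparison of norms then gives the whole family.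

    The integration is purely algebraic, by explicit primitives of polynomials;
    its monotonicity is the mean value theorem over a real closed field.  The
    norm is rational, so it suffices to argue over the real algebraic numbers. *)

(** * Subsets of a set with one more point *)

Definition shift (n : nat) (A : {set 'I_n}) : {set 'I_n.+1} := lift ord0 @: A.

Lemma ord0_notin_shift n (A : {set 'I_n}) : ord0 \notin shift A.
Proof. by apply/imsetP => -[i _ /eqP]; rewrite (negPf (neq_lift _ _)). Qed.

Lemma mem_shift n (A : {set 'I_n}) i : (lift ord0 i \in shift A) = (i \in A).
Proof. exact: (mem_imset _ _ lift_inj). Qed.

Lemma card_shift n (A : {set 'I_n}) : #|shift A| = #|A|.
Proof. exact: (card_imset _ lift_inj). Qed.

Lemma card_set_ord_le n (A : {set 'I_n}) : (#|A| <= n)%N.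
Proof. by rewrite -[leqRHS]card_ord max_card. Qed.

Lemma sum_set_ord0 (V : nmodType) (g : {set 'I_0} -> V) :
  \sum_(A : {set 'I_0}) g A = g set0.
Proof.
rewrite (bigD1 set0) //= big1 ?addr0 // => A /eqP[].
by apply/setP => -[].
Qed.

Lemma sum_set_ordS (V : nmodType) n (g : {set 'I_n.+1} -> V) :
  \sum_(A : {set 'I_n.+1}) g A =
  \sum_(A : {set 'I_n}) g (shift A) + \sum_(A : {set 'I_n}) g (ord0 |: shift A).
Proof.
pose unshift (B : {set 'I_n.+1}) : {set 'I_n} := [set i | lift ord0 i \in B].
have shiftK A : unshift (shift A) = A.
  by apply/setP => i; rewrite inE mem_shift.
have shiftUK A : unshift (ord0 |: shift A) = A.
  apply/setP => i; rewrite inE inE mem_shift inE.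
  by rewrite eq_sym (negPf (neq_lift _ _)).
rewrite (bigID (fun A : {set 'I_n.+1} => ord0 \notin A)) /=; congr (_ + _).
  rewrite (reindex_onto (@shift n) unshift) /= => [|B B0].
    by apply: eq_bigl => A; rewrite ord0_notin_shift shiftK eqxx.
  apply/setP => i; case: (unliftP ord0 i) => [j|] ->.
    by rewrite mem_shift inE.
  by rewrite (negPf B0) (negPf (ord0_notin_shift _)).
rewrite (reindex_onto (fun A => ord0 |: @shift n A) unshift) /= => [|B B0].
  by apply: eq_bigl => A; rewrite setU11 shiftUK eqxx.
apply/setP => i; case: (unliftP ord0 i) => [j|] ->.
  by rewrite in_setU1 mem_shift inE eq_sym (negPf (neq_lift _ _)).
by rewrite setU11; move: B0; rewrite negbK.
Qed.

(** * Expectations for the product measure of parameter p *)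

(** The expectation of [f] at a random subset of [n] that contains each point
    independently with probability [p]. *)
Definition mean (K : comNzRingType) n (p : K) (f : {set 'I_n} -> K) : K :=
  \sum_(A : {set 'I_n}) p ^+ #|A| * (1 - p) ^+ (n - #|A|) * f A.

Section Mean.
Variable K : realFieldType.
Implicit Type p : K.

Lemma mean0 p (f : {set 'I_0} -> K) : mean p f = f set0.
Proof. by rewrite /mean sum_set_ord0 cards0 !expr0 !mul1r. Qed.

Lemma meanS n p (f : {set 'I_n.+1} -> K) :
  mean p f = (1 - p) * mean p (fun A => f (shift A))
             + p * mean p (fun A => f (ord0 |: shift A)).
Proof.
rewrite /mean sum_set_ordS !mulr_sumr; congr (_ + _); apply: eq_bigr => A _.
  by rewrite card_shift subSn ?card_set_ord_le // exprS; ring.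
by rewrite cardsU1 ord0_notin_shift card_shift add1n subSS exprS; ring.
Qed.

Lemma mean_le n p (f g : {set 'I_n} -> K) :
  0 <= p <= 1 -> (forall A, f A <= g A) -> mean p f <= mean p g.
Proof.
move=> /andP[p0 p1] fg; apply: ler_sum => A _; apply: ler_wpM2l => //.
by rewrite mulr_ge0 ?exprn_ge0 ?subr_ge0.
Qed.

Lemma mean_compl n p (f : {set 'I_n} -> K) :
  mean (1 - p) f = mean p (fun A => f (~: A)).
Proof.
rewrite /mean (reindex_inj (inv_inj (@setCK _))) /=; apply: eq_bigr => A _.
by rewrite cardsCs setCK card_ord subKr subKn ?card_set_ord_le // [X in X * _]mulrC.
Qed.

Lemma mean_lin n p a b (f g : {set 'I_n} -> K) :
  mean p (fun A => a * f A + b * g A) = a * mean p f + b * mean p g.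
Proof. by rewrite /mean !mulr_sumr -big_split; apply: eq_bigr => A _ /=; ring. Qed.

Lemma mean_cst n p c : mean p (fun _ : {set 'I_n} => c) = c.
Proof.
by elim: n => [|n IH]; rewrite ?mean0 // meanS IH; ring.
Qed.

Lemma mean_ge0 n p (f : {set 'I_n} -> K) :
  0 <= p <= 1 -> (forall A, 0 <= f A) -> 0 <= mean p f.
Proof. by move=> p01 f0; rewrite -(mean_cst n p 0); apply: mean_le. Qed.

(** Harris' inequality (also known as Kleitman's): an increasing and a
    decreasing function are negatively correlated.  Conditioning on one point
    reduces it to the two-point case of Chebyshev's sum inequality, applied to
    the conditional expectations, which are again monotone. *)
Lemma harris n p (f g : {set 'I_n} -> K) : 0 <= p <= 1 ->
    (forall A B : {set 'I_n}, A \subset B -> f A <= f B) ->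
    (forall A B : {set 'I_n}, A \subset B -> g B <= g A) ->
  mean p (fun A => f A * g A) <= mean p f * mean p g.
Proof.
move=> p01; elim: n f g => [|n IH] f g fup gdn; first by rewrite !mean0.
have sub0 (A B : {set 'I_n}) : A \subset B -> shift A \subset shift B by apply: imsetS.
have sub1 (A B : {set 'I_n}) : A \subset B -> ord0 |: shift A \subset ord0 |: shift B.
  by move=> ?; rewrite setUS ?sub0.
have sub01 A : @shift n A \subset ord0 |: shift A by apply: subsetUr.
rewrite !meanS.
have h0 := IH (fun A => f (shift A)) (fun A => g (shift A))
  (fun A B s => fup _ _ (sub0 A B s)) (fun A B s => gdn _ _ (sub0 A B s)).
have h1 := IH (fun A => f (ord0 |: shift A)) (fun A => g (ord0 |: shift A))
  (fun A B s => fup _ _ (sub1 A B s)) (fun A B s => gdn _ _ (sub1 A B s)).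
have lf := mean_le p01 (fun A => fup _ _ (sub01 A)).
have lg := mean_le p01 (fun A => gdn _ _ (sub01 A)).
move: h0 h1 lf lg => /=.
move: (mean p (fun A => f (shift A))) (mean p (fun A => f (ord0 |: shift A))).
move: (mean p (fun A => g (shift A))) (mean p (fun A => g (ord0 |: shift A))).
move=> b0 b1 a0 a1 h0 h1 la lb; case/andP: p01 => p0 p1.
apply: (@le_trans _ _ ((1 - p) * (a0 * b0) + p * (a1 * b1))).
  by rewrite lerD // ler_wpM2l ?subr_ge0.
rewrite -subr_ge0.
have -> : ((1 - p) * a0 + p * a1) * ((1 - p) * b0 + p * b1) -
   ((1 - p) * (a0 * b0) + p * (a1 * b1)) = p * (1 - p) * ((a1 - a0) * (b0 - b1)).
  by ring.
by rewrite !mulr_ge0 ?subr_ge0.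
Qed.

(** The expectation of [f X * g Y] for a random pair (X, Y) of disjoint sets,
    where each point independently lies in neither set with probability
    [1 - 2p], in Y only with probability [p], and in X only with probability
    [p]; thus X and Y both have the law used in [mean].  Defining it by recursion
    on the points makes all its properties inductions. *)
Fixpoint disjoint_form n p : ({set 'I_n} -> K) -> ({set 'I_n} -> K) -> K :=
  match n return ({set 'I_n} -> K) -> ({set 'I_n} -> K) -> K with
  | 0 => fun f g => f set0 * g set0
  | m.+1 => fun f g =>
      (1 - p *+ 2) * disjoint_form p (fun A => f (shift A)) (fun A => g (shift A))
      + p * disjoint_form p (fun A => f (shift A)) (fun A => g (ord0 |: shift A))
      + p * disjoint_form p (fun A => f (ord0 |: shift A)) (fun A => g (shift A))
  end.

Lemma disjoint_form_linl n p a b (f f' g : {set 'I_n} -> K) :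
  disjoint_form p (fun A => a * f A + b * f' A) g =
  a * disjoint_form p f g + b * disjoint_form p f' g.
Proof.
elim: n f f' g => [|n IH] f f' g /=; first by ring.
by rewrite !IH; ring.
Qed.

Lemma disjoint_formC n p (f g : {set 'I_n} -> K) :
  disjoint_form p f g = disjoint_form p g f.
Proof.
elim: n f g => [|n IH] f g /=; first by ring.
by rewrite [X in _ * X]IH [X in _ + p * X + _]IH [X in _ + p * X]IH; ring.
Qed.

Lemma disjoint_form_eq0 n p (f g : {set 'I_n} -> K) :
  (forall A B : {set 'I_n}, A :&: B = set0 -> f A * g B = 0) ->
  disjoint_form p f g = 0.
Proof.
elim: n f g => [|n IH] f g fg0 /=; first by rewrite fg0 ?setI0.
have sI (A B : {set 'I_n}) : A :&: B = set0 -> @shift n A :&: shift B = set0.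
  by move=> AB; rewrite /shift -imsetI ?AB ?imset0 // => x y _ _; apply: lift_inj.
have s0 A : [set ord0] :&: @shift n A = set0.
  by apply/setP => x; rewrite !inE; case: eqP => // ->; apply/negbTE/ord0_notin_shift.
rewrite !IH; first by rewrite !mulr0 !addr0.
- move=> A B AB; apply: fg0; by rewrite setIUl sI // s0 setU0.
- move=> A B AB; apply: fg0; by rewrite setIUr sI // setIC s0 setU0.
- by move=> A B AB; apply: fg0; apply: sI.
Qed.

(** The Hoffman-type spectral bound.  The operator behind [disjoint_form] is the
    n-th tensor power of the operator with eigenvalue 1 on constants and
    - p / (1 - p) on functions of mean zero on one point, so for p <= 1/2 its
    spectrum apart from the constants lies in [- p / (1 - p), 1].  The first
    inequality is the lower bound on the quadratic form, with denominators
    cleared.  Both bounds are needed in the same induction: splitting [f] along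
    one point into its average [g] and its increment [h] diagonalizes the
    one-point operator, and the negative sign in front of the form of [h]
    exchanges the upper and the lower bound. *)
Lemma disjoint_form_bounds n p (f : {set 'I_n} -> K) : 0 <= p -> p *+ 2 <= 1 ->
  mean p f ^+ 2 - p * mean p (fun A => f A ^+ 2) <= (1 - p) * disjoint_form p f f
  /\ disjoint_form p f f <= mean p (fun A => f A ^+ 2).
Proof.
move=> p0 p2; elim: n f => [|n IH] f.
  rewrite !mean0 /= -expr2; split=> //.
  by rewrite le_eqVlt; apply/orP; left; apply/eqP; ring.
pose f0 (A : {set 'I_n}) := f (shift A).
pose f1 (A : {set 'I_n}) := f (ord0 |: shift A).
pose g (A : {set 'I_n}) := (1 - p) * f0 A + p * f1 A.
(* The coefficients -1 and 1 put h in the shape of the linearity lemmas. *)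
pose h (A : {set 'I_n}) := (-1) * f0 A + 1 * f1 A.
have Eg : mean p f = mean p g by rewrite meanS mean_lin.
(* p ^+ 2 is the eigenvalue p / (1 - p) times the variance p (1 - p). *)
have formE : disjoint_form p f f = disjoint_form p g g - p ^+ 2 * disjoint_form p h h.
  rewrite /= -/f0 -/f1 /g /h !disjoint_form_linl.
  rewrite ![disjoint_form p _ (fun A => _ + _)]disjoint_formC !disjoint_form_linl.
  by rewrite (disjoint_formC p f1 f0); ring.
have sqE : mean p (fun A => f A ^+ 2) =
    mean p (fun A => g A ^+ 2) + p * (1 - p) * mean p (fun A => h A ^+ 2).
  rewrite meanS -/(f0 _) /mean !mulr_sumr -!big_split /=; apply: eq_bigr => A _.
  by rewrite /g /h -/(f0 A) -/(f1 A); ring.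
have Eh0 : 0 <= mean p (fun A => h A ^+ 2).
  by apply: mean_ge0 => [|A]; [apply/andP; split; lra | apply: sqr_ge0].
have [g1 g2] := IH g; have [h1 h2] := IH h.
rewrite Eg formE sqE; move: g1 g2 h1 h2 Eh0.
move: (mean p g) (disjoint_form p g g) (disjoint_form p h h) (mean p h).
move: (mean p (fun A => h A ^+ 2)) (mean p (fun A => g A ^+ 2)).
move=> Eh2 Eg2 m Tg Th mh g1 g2 h1 h2 Eh0; split.
  have : (1 - p) * p ^+ 2 * Th <= (1 - p) * p ^+ 2 * Eh2.
    by rewrite ler_wpM2l // mulr_ge0 ?sqr_ge0 //; lra.
  lra.
have Thl : - Eh2 <= Th.
  have p1 : 0 < 1 - p by lra.
  rewrite -(ler_pM2l p1); apply: le_trans h1.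
  have := sqr_ge0 mh; have : 0 <= (1 - p *+ 2) * Eh2 by rewrite mulr_ge0 //; lra.
  lra.
have : p ^+ 2 * - Eh2 <= p ^+ 2 * Th by rewrite ler_wpM2l ?sqr_ge0.
have : 0 <= p * (1 - p *+ 2) * Eh2 by rewrite !mulr_ge0 //; lra.
lra.
Qed.

End Mean.

(** * The measure of intersecting families *)

Section Families.
Variables (K : realFieldType) (n : nat).
Implicit Types (p : K) (F S : {set {set 'I_n}}).

Definition mass p S : K := mean p (fun A => (A \in S)%:R).

Definition intersecting S := forall A B, A \in S -> B \in S -> A :&: B <> set0.

Definition compls S : {set {set 'I_n}} := [set A | ~: A \in S].

Lemma mass_ge0 p S : 0 <= p <= 1 -> 0 <= mass p S.
Proof. by move=> p01; apply: mean_ge0 => // A; rewrite ler0n. Qed.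

Lemma mass_compls p S : mass (1 - p) S = mass p (compls S).
Proof.
by rewrite /mass mean_compl; apply: eq_bigr => A _; rewrite inE.
Qed.

(** Two disjoint random sets are never both in [S], so the disjointness form
    vanishes at the indicator of [S], and its lower bound reads m^2 - p m <= 0
    for m = [mass p S]. *)
Lemma intersecting_mass_le p S : 0 <= p -> p *+ 2 <= 1 ->
  intersecting S -> mass p S <= p.
Proof.
move=> p0 p2 iS.
have [lo _] := disjoint_form_bounds (fun A => (A \in S)%:R) p0 p2.
have sq : mean p (fun A => (A \in S)%:R ^+ 2) = mass p S.
  by apply: eq_bigr => A _; case: (A \in S); rewrite ?expr1n ?expr0n.
rewrite disjoint_form_eq0 ?sq -/(mass p S) in lo; last first.
  move=> A B AB0; rewrite -natrM mulnb.
  by case: andP => // -[/iS h /h /(_ AB0)].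
have m0 : 0 <= mass p S by apply: mass_ge0; apply/andP; split; lra.
move: m0; rewrite le_eqVlt => /predU1P[<-//|m0].
by rewrite -subr_le0 -(pmulr_lle0 _ m0); lra.
Qed.

(** A set and its complement are not both in [S]. *)
Lemma intersecting_mass_add_le p S : 0 <= p <= 1 ->
  intersecting S -> mass p S + mass (1 - p) S <= 1.
Proof.
move=> p01 iS; rewrite mass_compls -(mul1r (mass p S)) -[mass p (compls _)]mul1r.
rewrite -mean_lin -[leRHS](mean_cst n p); apply: mean_le => // A.
rewrite !mul1r inE -natrD lern1.
case: (boolP (A \in S)) => // AS; case: (boolP (~: A \in S)) => // cAS.
by case: (iS _ _ AS cAS); rewrite setICr.
Qed.

Lemma leb_nat (a b : bool) : (a <= b)%N = (a ==> b).
Proof. by case: a; case: b. Qed.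

Definition upclosure F : {set {set 'I_n}} :=
  [set A : {set 'I_n} | [exists B : {set 'I_n} in F, B \subset A]].

Definition downclosure F : {set {set 'I_n}} :=
  [set A : {set 'I_n} | [exists B : {set 'I_n} in F, A \subset B]].

Lemma mass_le_mul_closures p F : 0 <= p <= 1 ->
  mass p F <= mass p (upclosure F) * mass p (downclosure F).
Proof.
move=> p01; apply: le_trans (harris p01 _ _).
- apply: mean_le => // A; rewrite -natrM mulnb ler_nat !inE.
  case: (boolP (A \in F)) => // AF.
  by rewrite lt0b; apply/andP; split; apply/exists_inP; exists A.
- move=> A B AB; rewrite ler_nat leb_nat !inE; apply/implyP.
  move=> /exists_inP[C CF CA]; apply/exists_inP.
  by exists C => //; apply: subset_trans AB.
- move=> A B AB; rewrite ler_nat leb_nat !inE; apply/implyP.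
  move=> /exists_inP[C CF CA]; apply/exists_inP.
  by exists C => //; apply: subset_trans CA.
Qed.

Lemma intersecting_upclosure F : IU_family F -> intersecting (upclosure F).
Proof.
move=> hF A B; rewrite !inE => /exists_inP[C CF CA] /exists_inP[D DF DB] AB0.
have [+ _] := hF _ _ CF DF; apply.
by apply/eqP; rewrite -subset0 -AB0 setISS.
Qed.

Lemma intersecting_compls_downclosure F :
  IU_family F -> intersecting (compls (downclosure F)).
Proof.
move=> hF A B; rewrite !inE => /exists_inP[C CF AC] /exists_inP[D DF BD] AB0.
have [_ +] := hF _ _ CF DF; apply.
by apply/eqP; rewrite -subTset -setC0 -AB0 setCI setUSS.
Qed.

(** The symmetrized estimate.  Each of the two masses alone may exceed
    [p * (1 - p)]: the up-closure is under control only for small [p], the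
    down-closure only for large [p]. *)
Lemma IU_mass_add_le p F : 0 <= p -> p *+ 2 <= 1 -> IU_family F ->
  mass p F + mass (1 - p) F <= (p * (1 - p)) *+ 2.
Proof.
move=> p0 p2 hF; have iU := intersecting_upclosure hF.
have iD := intersecting_compls_downclosure hF.
have p01 : 0 <= p <= 1 by apply/andP; split; lra.
have q01 : 0 <= 1 - p <= 1 by apply/andP; split; lra.
have fp := mass_le_mul_closures F p01; have fq := mass_le_mul_closures F q01.
have up := intersecting_mass_le p0 p2 iU.
have uq := intersecting_mass_add_le p01 iU.
have dq := intersecting_mass_le p0 p2 iD.
have dp := intersecting_mass_add_le p01 iD.
have dpE : mass (1 - p) (compls (downclosure F)) = mass p (downclosure F).
  by rewrite -mass_compls subKr.
rewrite dpE -mass_compls in dp; rewrite -mass_compls in dq.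
have := mass_ge0 (upclosure F) p01; have := mass_ge0 (downclosure F) p01.
have := mass_ge0 (upclosure F) q01; have := mass_ge0 (downclosure F) q01.
move: fp fq up uq dq dp; move: (mass p F) (mass (1 - p) F).
move: (mass p (upclosure F)) (mass (1 - p) (upclosure F)).
move: (mass p (downclosure F)) (mass (1 - p) (downclosure F)).
move=> d b a u f f' fp fq up uq dq dp b0 u0 d0 a0.
have h1 : a * d <= a * (1 - b) by rewrite ler_wpM2l //; lra.
have h2 : u * b <= (1 - a) * b by rewrite ler_wpM2r //; lra.
have h3 : 0 <= (p - a) * (1 - b *+ 2) by rewrite mulr_ge0 //; lra.
have h4 : 0 <= (p - b) * (1 - p *+ 2) by rewrite mulr_ge0 //; lra.
lra.
Qed.

End Families.

(** * Integration of polynomials over [0, 1] *)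

Section Integral.
Variable K : rcfType.
Implicit Types P Q : {poly K}.

(** The integral of [P] over [0, 1] is [c], as witnessed by a primitive; a
    relation is enough here because primitives are only built for explicit
    polynomials. *)
Definition integral01 P (c : K) := exists2 Q, Q^`() = P & Q.[1] - Q.[0] = c.

Lemma integral01D P1 c1 P2 c2 :
  integral01 P1 c1 -> integral01 P2 c2 -> integral01 (P1 + P2) (c1 + c2).
Proof.
by move=> [Q1 <- <-] [Q2 <- <-]; exists (Q1 + Q2); rewrite ?derivD // !hornerD; ring.
Qed.

Lemma integral01Z a P c : integral01 P c -> integral01 (a *: P) (a * c).
Proof.
by move=> [Q <- <-]; exists (a *: Q); rewrite ?derivZ // !hornerZ; ring.
Qed.

Lemma integral01_sum (I : finType) (r : pred I) (P : I -> {poly K}) (c : I -> K) :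
  (forall i, r i -> integral01 (P i) (c i)) ->
  integral01 (\sum_(i | r i) P i) (\sum_(i | r i) c i).
Proof.
move=> h; apply: (big_ind2 integral01) => //.
  by exists 0; rewrite ?derivC // !horner0 subrr.
by move=> *; apply: integral01D.
Qed.

(** Euler's Beta integral, by induction on [b] and integration by parts:
    (X^(a+1) (1-X)^(b+1))' = (a+1) X^a (1-X)^(b+1) - (b+1) X^(a+1) (1-X)^b. *)
Lemma integral01_beta a b :
  integral01 ('X^a * (1 - 'X) ^+ b) (a`!%:R * b`!%:R / (a + b).+1`!%:R).
Proof.
have S0 k : (k.+1%:R : K) != 0 by rewrite pnatr_eq0.
have F0 k : (k`!%:R : K) != 0 by rewrite pnatr_eq0 -lt0n fact_gt0.
elim: b a => [|b IH] a.
  exists (a.+1%:R^-1 *: 'X^(a.+1)).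
    by rewrite derivZ derivXn expr0 mulr1 -scaler_nat scalerA mulVf ?scale1r.
  rewrite !hornerZ !hornerXn expr1n expr0n addn0 factS natrM fact0 /=.
  by field; rewrite F0 nat1r S0.
have [Q dQ cQ] := IH a.+1.
exists (a.+1%:R^-1 *: ('X^(a.+1) * (1 - 'X) ^+ b.+1 + b.+1%:R *: Q)).
  rewrite derivZ derivD derivM derivXn derivZ dQ deriv_exp derivB derivX derivC.
  set D := (X in _ *: X); have -> : D = a.+1%:R *: ('X^a * (1 - 'X) ^+ b.+1).
    by rewrite /D /= -!mul_polyC !rmorph_nat; ring.
  by rewrite scalerA mulVf ?scale1r.
have <- : b.+1%:R * (Q.[1] - Q.[0]) / a.+1%:R =
    a`!%:R * b.+1`!%:R / (a + b.+1).+1`!%:R :> K.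
  rewrite cQ addSnnS.
  move: (F0 (a + b.+1).+1); move: ((a + b.+1).+1`!%:R : K) => M M0.
  by rewrite (factS a) (factS b) !natrM; field; rewrite M0 nat1r S0.
rewrite !(hornerE, hornerXn, horner_exp, subrr) !expr0n /=.
by field; rewrite nat1r S0.
Qed.

Lemma integral01_ge0 P c :
  integral01 P c -> (forall x, 0 <= x <= 1 -> 0 <= P.[x]) -> 0 <= c.
Proof.
move=> [Q dQ <-] P0; have [x] := poly_mvt Q (@ltr01 K).
rewrite inE /= => /andP[/ltW x0 /ltW x1] ->; rewrite dQ subr0 mulr1.
by apply: P0; rewrite x0 x1.
Qed.

(** The primitive is nondecreasing on [0, 1] and takes the same value at both
    ends, so it is constant on infinitely many points, here the 1 / (k + 1). *)
Lemma integral01_eq0 P :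
  integral01 P 0 -> (forall x, 0 <= x <= 1 -> 0 <= P.[x]) -> P = 0.
Proof.
move=> [Q dQ /eqP]; rewrite subr_eq0 => /eqP Q10 P0.
have mono x y : 0 <= x -> x <= y -> y <= 1 -> Q.[x] <= Q.[y].
  move=> x0; rewrite le_eqVlt => /predU1P[-> //|xy] y1.
  have [z] := poly_mvt Q xy; rewrite inE /= => /andP[/ltW xz /ltW zy] e.
  rewrite -subr_ge0 e dQ mulr_ge0 ?subr_ge0 ?(ltW xy) //; apply: P0.
  by rewrite (le_trans x0 xz) (le_trans zy y1).
have Qc x : 0 <= x <= 1 -> root (Q - Q.[0]%:P) x.
  case/andP=> x0 x1; rewrite /root !hornerE subr_eq0 eq_le -{1}Q10.
  by rewrite !mono.
pose rs := [seq (k.+1%:R^-1 : K) | k <- iota 0 (size (Q - Q.[0]%:P))].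
have urs : uniq rs.
  rewrite map_inj_uniq ?iota_uniq // => i j /invr_inj /eqP.
  by rewrite eqr_nat eqSS => /eqP.
have ars : all (root (Q - Q.[0]%:P)) rs.
  apply/allP => _ /mapP[k _ ->]; apply: Qc.
  by rewrite invr_ge0 ler0n invf_le1 ?ltr0n // ler1n.
have /eqP : Q - Q.[0]%:P = 0.
  apply/eqP; apply: contraT => nz.
  by have := max_poly_roots nz ars urs; rewrite size_map size_iota ltnn.
by rewrite subr_eq0 => /eqP QE; rewrite -dQ QE derivC.
Qed.

Lemma integral01_uniq P c d : integral01 P c -> integral01 P d -> c = d.
Proof.
have le e f : integral01 P e -> integral01 P f -> e <= f.
  move=> he hf; rewrite -subr_ge0 -mulN1r.
  apply: (integral01_ge0 (integral01D hf (integral01Z _ he))) => x _.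
  by rewrite scaleN1r subrr horner0.
by move=> hc hd; apply/eqP; rewrite eq_le !le.
Qed.

End Integral.

(** * The binomial norm as an integral *)

Definition star n (i j : 'I_n) : {set {set 'I_n}} :=
  [set A : {set 'I_n} | (i \in A) && (j \notin A)].

Section MassPolynomial.
Variables (K : rcfType) (n : nat).
Implicit Type F : {set {set 'I_n}}.

Definition mass_poly F : {poly K} :=
  \sum_(A in F) 'X^#|A| * (1 - 'X) ^+ (n - #|A|).

Lemma horner_mass_poly F x : (mass_poly F).[x] = mass x F.
Proof.
rewrite /mass_poly /mass /mean horner_sum big_mkcond; apply: eq_bigr => A _ /=.
by case: (A \in F); rewrite ?mulr1 ?mulr0 // !(hornerE, horner_exp).
Qed.

Lemma invr_binE k : (k <= n)%N ->
  'C(n, k)%:R^-1 = k`!%:R * (n - k)`!%:R / n`!%:R :> K.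
Proof.
move=> kn; rewrite -(bin_fact kn) !natrM.
have F0 m : (m`!%:R : K) != 0 by rewrite pnatr_eq0 -lt0n fact_gt0.
have C0 : ('C(n, k)%:R : K) != 0 by rewrite pnatr_eq0 -lt0n bin_gt0.
move: (F0 k) (F0 (n - k)%N) C0.
move: (k`!%:R : K) ((n - k)`!%:R : K) ('C(n, k)%:R : K) => x y z x0 y0 z0.
by field; rewrite x0 y0 z0.
Qed.

(** Allowing exponents [d A] other than [#|A|] covers at once the measure of
    parameter p (with [d A = #|A|]) and the one of parameter 1 - p (with
    [d A = n - #|A|]). *)
Lemma integral01_bernstein_sum F (d : {set 'I_n} -> nat) :
  (forall A, A \in F -> (d A <= n)%N /\ 'C(n, d A) = 'C(n, #|A|)) ->
  integral01 (\sum_(A in F) 'X^(d A) * (1 - 'X) ^+ (n - d A))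
             (binomial_norm K F / n.+1%:R).
Proof.
move=> dF; rewrite /binomial_norm mulr_suml; apply: integral01_sum => A AF.
have [dn <-] := dF A AF; rewrite invr_binE // -[X in integral01 _ X]mulrA -invfM.
rewrite -(natrM _ n`!) mulnC -factS.
by rewrite -[in n.+1](subnKC dn); apply: integral01_beta.
Qed.

Lemma integral01_mass_poly F :
  integral01 (mass_poly F) (binomial_norm K F / n.+1%:R).
Proof.
by apply: integral01_bernstein_sum => A _; rewrite card_set_ord_le.
Qed.

(** The product measure factors over the points: the point [i] contributes
    'X, the point [j] contributes 1 - 'X, and every other point contributes
    'X + (1 - 'X) = 1. *)
Lemma mass_poly_star (i j : 'I_n) : i != j ->
  mass_poly (star i j) = 'X * (1 - 'X).
Proof.
move=> ij; pose f k : {poly K} := if k == j then 0 else 'X.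
pose g k : {poly K} := if k == i then 0 else 1 - 'X.
have -> : 'X * (1 - 'X) = \prod_k (f k + g k).
  rewrite (bigD1 i) //= (bigD1 j) 1?eq_sym //= big1 /f /g ?eqxx ?(negPf ij) => [|k].
    by rewrite eq_sym (negPf ij) addr0 add0r mulr1.
  by case/andP => /negPf-> /negPf->; rewrite addrC subrK.
rewrite bigA_distr /mass_poly big_mkcond; apply: eq_bigr => A _ /=.
rewrite inE; have [iA|iA] /= := boolP (i \in A); last first.
  by rewrite (bigD1 i) //= (negPf iA) /g eqxx mul0r.
have [jA|jA] /= := boolP (j \in A).
  by rewrite (bigD1 j) //= jA /f eqxx mul0r.
rewrite (bigID (mem A)) /=; congr (_ * _).
  rewrite (eq_bigr (fun=> 'X)) ?prodr_const // => k kA; rewrite kA /f.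
  by case: eqP kA jA => // -> ->.
rewrite (eq_bigr (fun=> 1 - 'X)) => [|k kA].
  by rewrite prodr_const -[n in (n - _)%N]card_ord -(cardC (mem A)) addKn.
by rewrite (negPf kA) /g; case: eqP kA iA => // -> /negPf->.
Qed.

Lemma binomial_norm_star (i j : 'I_n) : i != j ->
  binomial_norm K (star i j) = n.+1%:R / 6.
Proof.
move=> ij; have := integral01_mass_poly (star i j); rewrite mass_poly_star //.
have := @integral01_beta K 1 1; rewrite !expr1 => h1 /(integral01_uniq h1) e.
have S0 : (n.+1%:R : K) != 0 by rewrite pnatr_eq0.
rewrite -[LHS](divfK S0) -e.
by rewrite !factS !fact0 !muln1 mul1r mulrC div1r.
Qed.

(** * The deficit polynomial *)

(** The polynomial 2 p (1 - p) - mu_p(F) - mu_{1-p}(F), see [horner_deficit]. *)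
Definition deficit F : {poly K} :=
  2 *: ('X * (1 - 'X))
  - \sum_(A in F) ('X^#|A| * (1 - 'X) ^+ (n - #|A|)
                   + 'X^(n - #|A|) * (1 - 'X) ^+ #|A|).

Lemma integral01_deficit F :
  integral01 (deficit F) (2 * (6^-1 - binomial_norm K F / n.+1%:R)).
Proof.
pose c := binomial_norm K F / n.+1%:R.
have -> : 2 * (6^-1 - c) = 2 * (1`!%:R * 1`!%:R / (1 + 1).+1`!%:R) + -1 * (c + c).
  by rewrite !factS !fact0 !muln1 mul1r; field.
rewrite /deficit -[X in integral01 (_ + X)]scaleN1r big_split.
apply: integral01D; apply: integral01Z; first exact: integral01_beta 1%N 1%N.
apply: integral01D; first exact: integral01_mass_poly.
rewrite (eq_bigr (fun A : {set 'I_n} => 'X^(n - #|A|) * (1 - 'X) ^+ (n - (n - #|A|)))).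
  apply: integral01_bernstein_sum => A _.
  by rewrite leq_subr bin_sub ?card_set_ord_le.
by move=> A _; rewrite subKn ?card_set_ord_le.
Qed.

Lemma horner_deficit F x :
  (deficit F).[x] = (x * (1 - x)) *+ 2 - (mass x F + mass (1 - x) F).
Proof.
rewrite -!horner_mass_poly /deficit /mass_poly !horner_sum -big_split /=.
rewrite hornerD hornerN hornerZ !hornerE horner_sum; congr (_ - _).
  by rewrite /= -mulrA mulr_natl.
apply: eq_bigr => A _; rewrite !(hornerE, horner_exp) subKr.
by rewrite [X in _ + X]mulrC.
Qed.

(** The deficit is symmetric under p <-> 1 - p, so p <= 1/2 is enough. *)
Lemma deficit_ge0 F x : IU_family F -> 0 <= x <= 1 -> 0 <= (deficit F).[x].
Proof.
move=> hF /andP[x0 x1]; rewrite horner_deficit subr_ge0.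
have [x2|x2] := leP (x *+ 2) 1; first exact: IU_mass_add_le.
have y0 : 0 <= 1 - x by lra.
have y2 : (1 - x) *+ 2 <= 1 by lra.
by have := IU_mass_add_le y0 y2 hF; rewrite subKr addrC [X in _ <= X *+ 2]mulrC.
Qed.

Lemma IU_card F A : IU_family F -> A \in F -> (0 < #|A| < n)%N.
Proof.
move=> hF AF; have [] := hF A A AF AF; rewrite setIid setUid => A0 AT.
rewrite card_gt0 ltn_neqAle card_set_ord_le andbT; apply/andP; split; apply/eqP => //.
move=> An; apply: AT; apply/eqP.
by rewrite eqEcard subsetT cardsT card_ord An leqnn.
Qed.

Lemma coef1_XnM a b : (0 < a)%N -> ('X^a * (1 - 'X) ^+ b : {poly K})`_1 = (a == 1%N)%:R.
Proof.
case: a => [//|a] _; rewrite exprS -mulrA coefXM /= coefXnM ltn_neqAle.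
case: a => [|a] //=.
by rewrite -horner_coef0 !(hornerE, horner_exp) subr0 expr1n.
Qed.

Lemma coef1_deficit F : IU_family F ->
  (deficit F)`_1 =
  2 - (#|[set A in F | #|A| == 1%N]| + #|[set A in F | #|A| == n.-1]|)%:R.
Proof.
move=> hF; have card_cond (c : pred nat) :
    (#|[set A in F | c #|A|]|)%:R = \sum_(A in F) (c #|A|)%:R :> K.
  rewrite -sum1_card natr_sum big_mkcond [RHS]big_mkcond /=.
  by apply: eq_bigr => A _; rewrite inE; case: (A \in F); case: (c _).
rewrite /deficit coefB coefZ coefXM coefB coefC coefX subr0 mulr1; congr (_ - _).
rewrite natrD (card_cond (fun k => k == 1%N)) (card_cond (fun k => k == n.-1)).
rewrite -big_split coef_sum; apply: eq_bigr => A AF /=.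
have /andP[A0 An] := IU_card hF AF.
rewrite coefD !coef1_XnM ?subn_gt0 //; congr (_ + _%:R); congr nat_of_bool; lia.
Qed.

(** An intersecting family has at most one singleton, and dually at most one
    complement of a singleton can be in [F]; the linear coefficient of the
    deficit vanishes only if both occur. *)
Lemma deficit_eq0_star F : (0 < n)%N -> IU_family F -> deficit F = 0 ->
  exists i j : 'I_n, i != j /\ F \subset star i j.
Proof.
move=> n0 hF D0; have := coef1_deficit hF; rewrite D0 coef0 => /eqP.
rewrite eq_sym subr_eq0 eqr_nat.
set S1 := [set A in F | _]; set S2 := [set A in F | _].
have le1 : (#|S1| <= 1)%N.
  apply/card_le1_eqP => A B; rewrite !inE.
  move=> /andP[AF /cards1P[x Ax]] /andP[BF /cards1P[y By]].
  have [+ _] := hF A B AF BF; rewrite Ax By.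
  by have [->//|xy []] := eqVneq x y; apply/eqP; rewrite setI_eq0 disjoints1 inE.
have card_compl (A : {set 'I_n}) : #|A| = n.-1 -> exists x, A = ~: [set x].
  move=> cA; have /cards1P[x Ax] : #|~: A| == 1%N.
    by rewrite cardsCs setCK card_ord cA -subn1 subKn.
  by exists x; rewrite -Ax setCK.
have le2 : (#|S2| <= 1)%N.
  apply/card_le1_eqP => A B; rewrite !inE.
  move=> /andP[AF /eqP /card_compl[x Ax]] /andP[BF /eqP /card_compl[y By]].
  have [_ +] := hF A B AF BF; rewrite Ax By.
  have [->//|xy []] := eqVneq x y; rewrite -setCI -setC0; congr (~: _).
  by apply/eqP; rewrite setI_eq0 disjoints1 inE.
move=> /eqP S12.
have /card_gt0P[A] : (0 < #|S1|)%N by lia.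
have /card_gt0P[B] : (0 < #|S2|)%N by lia.
rewrite !inE => /andP[BF /eqP /card_compl[j Bj]] /andP[AF /cards1P[i Ai]].
subst A B; exists i, j; split.
  apply/eqP => ij; have [+ _] := hF _ _ AF BF; apply.
  by rewrite ij setICr.
apply/subsetP => C CF; rewrite inE; apply/andP; split.
  apply: contraT => iC; have [+ _] := hF _ _ AF CF; case.
  by apply/eqP; rewrite setI_eq0 disjoints1.
apply/negP => jC; have [_ +] := hF _ _ CF BF; apply.
apply/setP => x; rewrite !inE; case: eqP => [->|]; by rewrite ?jC ?orbT.
Qed.

(** * The bound and the equality case *)

Lemma IU_binomial_norm_rcf F : (0 < n)%N -> IU_family F ->
  binomial_norm K F <= n.+1%:R / 6 /\
  (binomial_norm K F = n.+1%:R / 6 <->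
   exists i j : 'I_n, i <> j /\ F = star i j).
Proof.
move=> n0 hF; have S0 : 0 < (n.+1%:R : K) by rewrite ltr0n.
have hD := integral01_deficit F; have D0 := fun x => @deficit_ge0 F x hF.
split; last split.
- have := integral01_ge0 hD D0.
  by rewrite pmulr_rge0 // subr_ge0 ler_pdivrMr // mulrC.
- move=> eF; rewrite eF mulrAC divff ?gt_eqF // mul1r subrr mulr0 in hD.
  have [i [j [ij sF]]] := deficit_eq0_star n0 hF (integral01_eq0 hD D0).
  exists i, j; split; first exact/eqP.
  apply/eqP; rewrite eqEsubset sF; apply/subsetP => A AS; apply: contraT => AF.
  have := binomial_norm_star ij; rewrite -eF /binomial_norm.
  rewrite (big_setID F) /= (setIidPr sF) => /eqP; rewrite -subr_eq0 addrAC subrr.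
  rewrite add0r (bigD1 A) ?in_setD ?AF //= gt_eqF //.
  apply: ltr_wpDr; first by apply: sumr_ge0 => B _; rewrite invr_ge0 ler0n.
  by rewrite invr_gt0 ltr0n bin_gt0 card_set_ord_le.
- by move=> [i [j [/eqP ij ->]]]; apply: binomial_norm_star.
Qed.

End MassPolynomial.

(** Norms and bound come from rational numbers, so the statement does not depend
    on the ordered field. *)
Lemma ratr_binomial_norm (R : realFieldType) n (F : {set {set 'I_n}}) :
  ratr (binomial_norm rat F) = binomial_norm R F.
Proof.
rewrite /binomial_norm rmorph_sum; apply: eq_bigr => A _.
by rewrite /= fmorphV rmorph_nat.
Qed.

Theorem theorem1p2 (R : realFieldType) (n : nat) (hn : (0 < n)%N)
    (F : {set {set 'I_n}}) (hF : IU_family F) :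
  binomial_norm R F <= (n.+1)%:R / 6 /\
  (binomial_norm R F = (n.+1)%:R / 6 <->
   exists i j : 'I_n,
     i <> j /\ F = [set A : {set 'I_n} | (i \in A) && (j \notin A)]).
Proof.
have bound (K : realFieldType) : ratr (n.+1%:R / 6) = n.+1%:R / 6 :> K.
  by rewrite fmorph_div !rmorph_nat.
have [le eq] := IU_binomial_norm_rcf realalg hn hF.
rewrite -ratr_binomial_norm -bound ler_rat in le.
rewrite -ratr_binomial_norm -bound in eq.
rewrite -ratr_binomial_norm -bound ler_rat; split=> //; rewrite -eq.
by split=> /(fmorph_inj _) ->.
Qed.
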